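(* Any streaming certification scheme for $\mathrm{Coloring}_{\leq}$ whose verifier uses $m$ bits of memory and whose certificates have $c$ bits satisfies $c+m=\Omega(n\log n)$ on $n$-node graphs.
   Context: $\mathrm{Coloring}_{\leq}$ takes as input a graph $G$ and a threshold $k$ and asks whether the chromatic number of $G$ is at most $k$. Inputs: an $n$-node graph on $[n]$ and threshold $k$; $k$ is given first, then the edges arrive as a stream in an arbitrary, possibly adversarial, order. A streaming certification scheme for a decision problem $P$ consists of a prover (a computationally unlimited function producing a certificate in $\{0,1\}^*$ depending only on the input, not on the edge order) and a verifier (a deterministic streaming algorithm with read-only access to the certificate that processes the stream and outputs accept or reject). Completeness: if the input satisfies $P$, some certificate makes the verifier accept for every edge order. Soundness: if the input does not satisfy $P$, the verifier rejects for every certificate and every edge order. $c$ is the certificate length and $m$ the verifier's memory excluding the certificate, as worst-case functions of $n$. *)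

(* Defs.v *)
From mathcomp Require Import all_boot.

Set Implicit Arguments.
Unset Strict Implicit.
Unset Printing Implicit Defensive.

Record sgraph (n : nat) := SGraph {
  edges : {set {set 'I_n}};
  edges_card2 : forall e : {set 'I_n}, e \in edges -> #|e| = 2
}.

Definition colorable n (G : sgraph n) (k : nat) : bool :=
  [exists f : {ffun 'I_n -> 'I_k},
     forall x, forall y, ([set x; y] \in edges G) ==> (f x != f y)].

Lemma colorable_card n (G : sgraph n) : colorable G n.
Proof.
apply/existsP; exists [ffun x => x].
apply/forallP => x; apply/forallP => y; apply/implyP => /edges_card2.
by rewrite !ffunE cards2; case: (x != y).
Qed.

Definition chromatic_number n (G : sgraph n) : nat :=
  ex_minn (ex_intro (colorable G) n (colorable_card G)).

Definition instance (n : nat) : Type := (sgraph n * nat)%type.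

Definition decision_problem : Type := forall n : nat, instance n -> Prop.

Definition coloring_le : decision_problem :=
  fun n x => chromatic_number x.1 <= x.2.

Definition bits : Type := seq bool.

Inductive item (n : nat) : Type :=
  | Threshold of nat
  | Edge of {set 'I_n}.

(* Every edge arrives exactly once, after the threshold. *)
Definition stream_of n (x : instance n) (s : seq (item n)) : Prop :=
  exists2 es : seq {set 'I_n},
    perm_eq es (enum (edges x.1)) & s = Threshold n x.2 :: map (@Edge n) es.

(* The certificate [w] is an argument of [step] and [output] and is never
   counted as memory. The maps are arbitrary functions, chosen separately for
   each [n]; no uniformity or computability in [n] is required. *)
Record verifier (n : nat) := Verifier {
  init : bits;
  step : bits -> bits -> item n -> bits; (* step w memory item *)
  output : bits -> bits -> bool          (* output w memory *)
}.

Definition run n (V : verifier n) (w : bits) (s : seq (item n)) : bits :=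
  foldl (step V w) (init V) s.

Definition accepts n (V : verifier n) (w : bits) (s : seq (item n)) : bool :=
  output V w (run V w s).

Record certification_scheme (P : decision_problem) := CertificationScheme {
  prover : forall n : nat, instance n -> bits;
  verify : forall n : nat, verifier n;
  completeness : forall (n : nat) (x : instance n), P n x ->
    forall s, stream_of x s -> accepts (verify n) (prover x) s;
  soundness : forall (n : nat) (x : instance n), ~ P n x ->
    forall w s, stream_of x s -> ~~ accepts (verify n) w s
}.

(* The prover's output on no-instances is irrelevant to the scheme. *)
Definition certificate_bits P (S : certification_scheme P) (c : nat -> nat) :
    Prop :=
  forall (n : nat) (x : instance n), P n x -> size (prover S x) <= c n.

(* Worst case over all instances, edge orders, moments of the run and
   certificates of at most [c n] bits. *)
Definition memory_bits P (S : certification_scheme P) (c m : nat -> nat) :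
    Prop :=
  forall (n : nat) (x : instance n) (w : bits) (s : seq (item n)) (t : nat),
    size w <= c n -> stream_of x s ->
    size (run (verify S n) w (take t s)) <= m n.

(* Main.v *)
(** With [k] colours, a clique [u] on [k] vertices fixes the names of the
    colours, and each [u' i] is joined to every [u i'] with [i' <> i] so that it
    repeats the colour of [u i]. Joining [v j] to every [u i] with [i <> f j]
    forces colour [f j] on it, and joining it to every [u' i] with [i <> g j]
    forces colour [g j]: the graph is [k]-colourable if and only if [f = g].
    When the edges depending on [f] arrive before those depending on [g], the
    certificate together with the memory at the cut determines [f]; with
    [k = n %/ 3] this leaves room for [k ^ k] values only if
    [k ^ k <= 2 ^ (c + m + 2)]. *)
Require Import Defs.
From mathcomp Require Import all_boot all_order all_algebra.
From mathcomp Require Import all_classical all_reals all_analysis.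
From mathcomp Require Import zify.
Import numFieldNormedType.Exports.
Local Open Scope classical_set_scope.
Local Open Scope ring_scope.
Import Order.TTheory GRing.Theory Num.Theory.

Set Implicit Arguments.
Unset Strict Implicit.
Unset Printing Implicit Defensive.

Lemma chromatic_number_le n (G : sgraph n) k :
  (chromatic_number G <= k)%N = colorable G k.
Proof.
rewrite /chromatic_number; case: ex_minnP => j col_j min_j.
apply/idP/idP => [le_jk|/min_j//].
have /existsP[h /forallP col_h] := col_j.
apply/existsP; exists [ffun x => widen_ord le_jk (h x)].
apply/forallP => x; apply/forallP => y; apply/implyP => xyG.
have /forallP/(_ y)/implyP/(_ xyG) := col_h x.
by rewrite !ffunE -!(inj_eq val_inj).
Qed.

(** The image of a pair has two elements exactly when the map separates the pair, however the pair
    is written; this avoids matching up the endpoints of unordered edges. *)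
Lemma imset_pair_neq (aT rT : finType) (h : aT -> rT) (x y a b : aT) :
  [set x; y]%SET = [set a; b]%SET -> h a != h b -> h x != h y.
Proof.
move=> /(congr1 (fun e : {set aT} => #|h @: e|)).
by rewrite !imsetU !imset_set1 !cards2; case: (h x != h y); case: (h a != h b).
Qed.

Definition crossing_edges n k (p q : 'I_k -> 'I_n) (r : rel 'I_k) :
    {set {set 'I_n}} :=
  [set [set p ij.1; q ij.2]%SET | ij in [set ij : 'I_k * 'I_k | r ij.1 ij.2]%SET]%SET.

Lemma crossing_edgesP n k (p q : 'I_k -> 'I_n) (r : rel 'I_k) e :
  reflect (exists i j, r i j /\ e = [set p i; q j]%SET)
          (e \in crossing_edges p q r).
Proof.
apply: (iffP imsetP) => [[[i j]]|[i [j [rij ->]]]].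
  by rewrite inE /= => rij ->; exists i, j.
by exists (i, j); rewrite ?inE.
Qed.

(** * The graph encoding two functions *)

Section TwoFunctionGraph.
Variables (n k : nat) (le_3k_n : (3 * k <= n)%N).

Lemma block_subproof (b : 'I_3) (i : 'I_k) : (b * k + i < n)%N.
Proof.
apply: leq_trans le_3k_n; apply: (@leq_trans (b.+1 * k)%N).
  by rewrite mulSn addnC ltn_add2r.
by rewrite leq_mul2r ltn_ord orbT.
Qed.

(** Three consecutive intervals of length [k] hold the vertices [u], [u'] and [v]; vertices from
    [3 * k] on stay isolated. *)
Definition block (b : 'I_3) (i : 'I_k) : 'I_n := Ordinal (block_subproof b i).

Lemma block_inj b b' i i' : block b i = block b' i' -> b = b' /\ i = i'.
Proof.
move=> /(congr1 val)/= eq_bi; have k_gt0 : (0 < k)%N by exact: leq_ltn_trans (ltn_ord i).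
split; apply: val_inj.
  by move/(congr1 (divn^~ k)): eq_bi; rewrite !divnMDl // !divn_small // !addn0.
by move/(congr1 (modn^~ k)): eq_bi; rewrite !modnMDl !modn_small.
Qed.

Let u := block (inord 0).
Let u' := block (inord 1).
Let v := block (inord 2).

Let neq_uu' i j : u i != u' j.
Proof. by apply/eqP => /block_inj[/(congr1 val)]; rewrite /= !inordK. Qed.

Let neq_uv i j : u i != v j.
Proof. by apply/eqP => /block_inj[/(congr1 val)]; rewrite /= !inordK. Qed.

Let neq_u'v i j : u' i != v j.
Proof. by apply/eqP => /block_inj[/(congr1 val)]; rewrite /= !inordK. Qed.

Definition first_edges (f : 'I_k -> 'I_k) : {set {set 'I_n}} :=
  (crossing_edges u u (fun i i' => i != i')
   :|: crossing_edges u u' (fun i i' => i != i')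
   :|: crossing_edges u v (fun i j => i != f j))%SET.

Definition second_edges (g : 'I_k -> 'I_k) : {set {set 'I_n}} :=
  crossing_edges u' v (fun i j => i != g j).

Lemma two_function_edges_card2 f g (e : {set 'I_n}) :
  e \in (first_edges f :|: second_edges g)%SET -> #|e| = 2%N.
Proof.
rewrite !inE -!orbA => /or4P[] /crossing_edgesP[i [j [rij ->]]]; rewrite cards2.
- suff -> : u i != u j by [].
  by apply: contra_neq rij => /block_inj[].
- by rewrite neq_uu'.
- by rewrite neq_uv.
- by rewrite neq_u'v.
Qed.

Definition two_function_graph f g : sgraph n :=
  SGraph (@two_function_edges_card2 f g).

(** Every first edge has an endpoint among the [u l], and no second edge does. Hence the
    concatenated stream lists each edge once. *)
Lemma first_second_disjoint f g e :
  e \in first_edges f -> e \in second_edges g -> False.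
Proof.
move=> eA /crossing_edgesP[i [j [_ eE]]].
have no_u l : (u l \in e) = false.
  by rewrite eE !inE (negPf (neq_uu' _ _)) (negPf (neq_uv _ _)).
move: eA; rewrite !inE -!orbA.
by case/or3P => /crossing_edgesP[a [b [_ eE']]];
  have := no_u a; rewrite eE' !inE eqxx.
Qed.

Definition two_function_stream f g : seq (item n) :=
  Threshold n k :: [seq Edge e | e <- enum (first_edges f)]
    ++ [seq Edge e | e <- enum (second_edges g)].

Lemma two_function_stream_of f g :
  stream_of (two_function_graph f g, k) (two_function_stream f g).
Proof.
exists (enum (first_edges f) ++ enum (second_edges g)); last by rewrite map_cat.
apply: uniq_perm; rewrite ?enum_uniq //; last first.
  by move=> e; rewrite mem_cat !mem_enum -finset.in_setU.
rewrite cat_uniq !enum_uniq andbT; apply/hasPn => e; rewrite !mem_enum => eB.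
by apply/negP => eA; exact: first_second_disjoint eA eB.
Qed.

Lemma two_function_graph_colorable f :
  (0 < k)%N -> colorable (two_function_graph f f) k.
Proof.
move=> k_gt0.
pose pos (x : 'I_n) := Ordinal (ltn_pmod x k_gt0).
(* Vertices outside the three blocks are isolated, so the colour they get here is immaterial. *)
pose h (x : 'I_n) := if (x %/ k == 2)%N then f (pos x) else pos x.
have h_block b i : h (block b i) = if b == inord 2 then f i else i.
  have -> : (b == inord 2) = (b == 2 :> nat) by rewrite -val_eqE /= inordK.
  rewrite /h /= divnMDl // divn_small // addn0.
  suff -> : pos (block b i) = i by [].
  by apply: val_inj; rewrite /= modnMDl modn_small.
have hu i : h (u i) = i by rewrite h_block -val_eqE /= !inordK.
have hu' i : h (u' i) = i by rewrite h_block -val_eqE /= !inordK.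
have hv j : h (v j) = f j by rewrite h_block eqxx.
apply/existsP; exists [ffun x => h x].
apply/forallP => x; apply/forallP => y; apply/implyP; rewrite !ffunE !inE -!orbA.
(* In each of the four edge families, the inequality of colours is the relation defining the
   family. *)
by case/or4P => /crossing_edgesP[i [j [rij /imset_pair_neq]]]; apply;
  rewrite ?hu ?hu' ?hv.
Qed.

Lemma colorable_two_function_graph f g :
  colorable (two_function_graph f g) k -> f =1 g.
Proof.
move=> /existsP[h /forallP col_h] j.
have colP x y : [set x; y]%SET \in edges (two_function_graph f g) -> h x != h y.
  by move: (col_h x) => /forallP/(_ y)/implyP.
have hu_inj : injective (h \o u).
  move=> i i' /= eq_h; apply: contra_eq eq_h => ii'; apply: colP.
  by rewrite !inE; apply/orP; left; apply/orP; left; apply/orP; left;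
    apply/crossing_edgesP; exists i, i'.
(* The clique uses all [k] colours; [hu] sends a colour to the index of the clique vertex that has
   it. *)
have [hu hK Kh] := injF_bij hu_inj.
have hu' i : h (u' i) = h (u i).
  have := Kh (h (u' i)); rewrite /= => hE.
  have [eq_i|ne] := eqVneq (hu (h (u' i))) i; first by rewrite -[LHS]hE eq_i.
  (* Otherwise the clique vertex with the colour of [u' i] would be a neighbour of [u' i]. *)
  suff /eqP : h (u (hu (h (u' i)))) != h (u' i) by [].
  apply: colP; rewrite !inE; apply/orP; left; apply/orP; left; apply/orP; right.
  by apply/crossing_edgesP; exists (hu (h (u' i))), i.
(* Both [u i] and [u' i] have the colour of [v j], so neither is adjacent to [v j]: this gives
   [i = f j] and [i = g j]. *)
set i := hu (h (v j)).
have hi : h (u i) = h (v j) by exact: Kh.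
have -> : f j = i.
  apply: contra_eq hi => ne; apply: colP.
  rewrite !inE; apply/orP; left; apply/orP; right.
  by apply/crossing_edgesP; exists i, j; rewrite eq_sym.
apply: contra_eq hi => ne; rewrite -hu'; apply: colP.
rewrite !inE; apply/orP; right.
by apply/crossing_edgesP; exists i, j.
Qed.

End TwoFunctionGraph.

(** * Counting certificates and memory states, and the asymptotic bound *)

Lemma card_bseq_bool l : (#|{: {bseq l of bool}}| <= 2 ^ l.+1)%N.
Proof.
rewrite card_bseq card_bool; apply: ltnW.
elim: l => [|l IHl]; first by rewrite big_ord_recr big_ord0.
by rewrite big_ord_recr /= [X in (_ < X)%N]expnS mul2n -addnn ltn_add2r.
Qed.

(** If distinct [f] and [g] shared both certificate and memory at the cut, the run on [G f g] would
    end like the accepting run on [G g g], against soundness. *)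
Lemma scheme_counting (S : certification_scheme coloring_le) (c m : nat -> nat)
    (n k : nat) : certificate_bits S c -> memory_bits S c m ->
  (0 < k)%N -> (3 * k <= n)%N -> (k ^ k <= 2 ^ (c n + m n + 2))%N.
Proof.
move=> hc hm k_gt0 le3k.
pose G (f g : {ffun 'I_k -> 'I_k}) := two_function_graph le3k f g.
have yes f : coloring_le (G f f, k).
  by rewrite /coloring_le /= chromatic_number_le two_function_graph_colorable.
pose w f := prover S (G f f, k).
pose front (f : {ffun 'I_k -> 'I_k}) :=
  Threshold n k :: [seq Edge e | e <- enum (first_edges le3k f)].
pose s f := run (verify S n) (w f) (front f).
have size_w f : (size (w f) <= c n)%N by exact: hc (yes f).
have size_s f : (size (s f) <= m n)%N.
  have := hm n _ (w f) _ (size (front f)) (size_w f)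
    (two_function_stream_of le3k f f).
  by rewrite /two_function_stream -cat_cons take_size_cat.
pose code (f : {ffun 'I_k -> 'I_k}) :
    {bseq (c n) of bool} * {bseq (m n) of bool} := (Bseq (size_w f), Bseq (size_s f)).
have code_inj : injective code.
  move=> f g [eq_w eq_s].
  apply/ffunP; apply: (@colorable_two_function_graph n k le3k).
  apply: contraT => not_col.
  have : ~ coloring_le (G f g, k).
    by rewrite /coloring_le /= chromatic_number_le; apply/negP.
  move=> /(soundness S)/(_ (w f) _ (two_function_stream_of le3k f g)).
  have := completeness S (yes g) (two_function_stream_of le3k g g).
  rewrite /accepts /two_function_stream -!cat_cons /run !foldl_cat.
  by rewrite -!/(run _ _ _) -/(w g) -eq_w -/(front f) -/(front g) -/(s f) eq_s
    /s eq_w => ->.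
rewrite -[X in (X ^ _)%N]card_ord -[X in (_ ^ X)%N]card_ord -card_ffun.
apply: leq_trans (leq_card code code_inj) _.
(* The summand 2 is one unit for each of the two strings, whose length may be anything up to its
   bound. *)
rewrite card_prod addn2 -addSn -addnS expnD.
by apply: leq_mul; exact: card_bseq_bool.
Qed.

(** With [k = n %/ 3], [n <= k ^ 2] and [n <= 4 * k] give [n ^ n <= (k ^ k) ^ 8 <= 2 ^ (8 * (a +
    2))], and [8 * (a + 2) <= 24 * a] once [a >= 1]. *)
Lemma nlogn_le_of_counting (n a : nat) : (16 <= n)%N ->
  ((n %/ 3) ^ (n %/ 3) <= 2 ^ (a + 2))%N -> (n ^ n <= 2 ^ (24 * a))%N.
Proof.
move=> n16; set k := (n %/ 3)%N => le_kk.
have k4 : (4 < k)%N by rewrite /k; lia.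
(* For [a = 0] the hypothesis would read [k ^ k <= 4], although [k > 4]. *)
have a_ge1 : (1 <= a)%N.
  case: a le_kk => // le_kk.
  have : (4 ^ 4 <= k ^ k)%N.
    apply: (@leq_trans (4 ^ k)%N); first by rewrite leq_pexp2l // ltnW.
    by rewrite leq_exp2r ?(ltnW k4) // (leq_trans _ k4).
  by move/leq_trans/(_ le_kk).
have n_le_sq : (n <= k ^ 2)%N by rewrite /k; nia.
have n_le : (n <= 4 * k)%N by rewrite /k; lia.
apply: (@leq_trans ((k ^ 2) ^ (4 * k))%N).
  apply: (@leq_trans ((k ^ 2) ^ n)%N).
    by rewrite leq_exp2r //; lia.
  by rewrite leq_pexp2l // expn_gt0; lia.
rewrite -expnM mulnA (mulnC _ k) expnM.
apply: (@leq_trans ((2 ^ (a + 2)) ^ 8)%N); first by rewrite leq_exp2r.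
by rewrite -expnM leq_pexp2l //; lia.
Qed.

Theorem theorem14 (R : realType) (S : certification_scheme coloring_le)
    (c m : nat -> nat) (hc : certificate_bits S c) (hm : memory_bits S c m) :
  (fun n : nat => (c n + m n)%:R : R^o)
    \is 'Omega_\oo (fun n : nat => n%:R * ln n%:R : R^o).
Proof.
(* The constant 48 is 24, from [n ^ n <= 2 ^ (24 * (c n + m n))], times 2, from [ln 2 < 2]. *)
rewrite qualifE; apply/asboolP; exists 48^-1; first by rewrite invr_gt0.
near=> n.
have n16 : (16 <= n)%N by near: n; exact: nbhs_infty_ge.
have le_nn : (n ^ n <= 2 ^ (24 * (c n + m n)))%N.
  by apply: nlogn_le_of_counting (scheme_counting hc hm _ _) => //; lia.
have n_gt0 : 0 < n%:R :> R by rewrite ltr0n; lia.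
rewrite ler_pdivrMl // normr_nat ger0_norm; last first.
  by rewrite mulr_ge0 // ln_ge0 // ler1n -(ltr0n R).
rewrite mulrC mulr_natr -lnXn // -natrX.
apply: (@le_trans _ _ (ln (2 ^+ (24 * (c n + m n))))).
  by rewrite ler_ln ?posrE ?exprn_gt0 // -?natrX ?ler_nat // ltr0n expn_gt0; lia.
rewrite lnXn // -(natrM _ 48) -(mulr_natr (ln 2)).
have -> : (48 * (c n + m n) = 2 * (24 * (c n + m n)))%N by lia.
by rewrite [leRHS]natrM ler_wpM2r // ltW // ln_sublinear.
Unshelve. all: by end_near.
Qed.
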